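(* Let $\Bbbk$ be a field, let $\Bbbk[\mathbf{x}] = \Bbbk[x_1,\ldots,x_n]$ be a polynomial ring in $n$ variables, let $I \subseteq \Bbbk[\mathbf{x}]$ be an ideal, and let $A \in \mathbb{Z}^{d \times n}$ be a $d \times n$ integer matrix with column vectors $\mathbf{a}_1,\ldots,\mathbf{a}_n \in \mathbb{Z}^d$. Let $\mathbf{t} = t_1,\ldots,t_d$ be a new set of variables, and denote by $\mathbf{t}.I \subseteq \Bbbk[\mathbf{x}][\mathbf{t}^{\pm 1}]$ the ideal whose generators are those of $I$ with each variable $x_i$ replaced by $\mathbf{t}^{\mathbf{a}_i} x_i$. Then the largest $A$-graded ideal of $\Bbbk[\mathbf{x}]$ contained in $I$ equals the intersection $(\mathbf{t}.I) \cap \Bbbk[\mathbf{x}]$.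
   Context: The ring $\Bbbk[\mathbf{x}][\mathbf{t}^{\pm 1}] = \Bbbk[x_1,\ldots,x_n][t_1^{\pm 1},\ldots,t_d^{\pm 1}]$ is the Laurent polynomial ring in $t_1,\ldots,t_d$ over $\Bbbk[\mathbf{x}]$, and $\Bbbk[\mathbf{x}]$ is regarded as a subring of it in the natural way. For $\mathbf{a} = (a_1,\ldots,a_d) \in \mathbb{Z}^d$, write $\mathbf{t}^{\mathbf{a}} = t_1^{a_1}\cdots t_d^{a_d}$. The ideal $\mathbf{t}.I$ is the ideal of $\Bbbk[\mathbf{x}][\mathbf{t}^{\pm 1}]$ generated by the elements $f(\mathbf{t}^{\mathbf{a}_1}x_1,\ldots,\mathbf{t}^{\mathbf{a}_n}x_n)$ as $f(x_1,\ldots,x_n)$ ranges over a generating set of $I$ (the resulting ideal does not depend on the choice of generating set). The polynomial ring $\Bbbk[\mathbf{x}]$ is $A$-graded by assigning to each monomial $\mathbf{x}^{\mathbf{b}} = x_1^{b_1}\cdots x_n^{b_n}$ the $A$-degree $\deg(\mathbf{x}^{\mathbf{b}}) = A\mathbf{b} = b_1\mathbf{a}_1 + \cdots + b_n\mathbf{a}_n \in \mathbb{Z}^d$. An ideal of $\Bbbk[\mathbf{x}]$ is $A$-graded if it is generated by polynomials each of which has all of its terms of the same $A$-degree (different generators may have different $A$-degrees). ''Largest'' is with respect to inclusion: the largest $A$-graded ideal contained in $I$ is an $A$-graded ideal contained in $I$ that contains every $A$-graded ideal contained in $I$. *)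

(* Defs.v *)
From HB Require Import structures.
From mathcomp Require Import all_boot all_order all_algebra.
From mathcomp Require Import finmap.
(* The notations of monalg would hide those of mpoly, {mpoly R[n]} among them. *)
From mathcomp Require Import -(notations) monalg.
From mathcomp Require Import xfinmap mpoly.

Set Implicit Arguments.
Unset Strict Implicit.
Unset Printing Implicit Defensive.

Import GRing.Theory.
Local Open Scope ring_scope.

Section LaurentMul.
Variables (d : nat) (R : comNzRingType).
Implicit Types (p q r : malg 'cV[int]_d R) (a b : 'cV[int]_d).

Local Notation supp := monalg.msupp.
Local Notation coef := monalg.mcoeff.

Definition lone : malg 'cV[int]_d R := mkmalgU 0 1.

Definition lmul p q : malg 'cV[int]_d R :=
  \sum_(a <- supp p) \sum_(b <- supp q) mkmalgU (a + b) (coef a p * coef b q).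

Lemma lmulw (D E : {fset 'cV[int]_d}) p q :
  (supp p `<=` D)%fset -> (supp q `<=` E)%fset ->
  lmul p q =
    \sum_(a <- D) \sum_(b <- E) mkmalgU (a + b) (coef a p * coef b q).
Proof.
move=> leD leE; rewrite /lmul (big_fset_incl _ leD) /=.
  apply/eq_bigr=> a _; apply/big_fset_incl => // b _ /mcoeff_outdom ->.
  by rewrite mulr0 monalgU0.
move=> a _ /mcoeff_outdom pa.
by rewrite big1 => // b _; rewrite pa mul0r monalgU0.
Qed.

Lemma lmulUU c1 c2 a b :
  lmul (mkmalgU a c1) (mkmalgU b c2) = mkmalgU (a + b) (c1 * c2).
Proof. by rewrite (lmulw msuppU_le msuppU_le) !big_seq_fset1 !mcoeffUU. Qed.

Lemma lmulC : commutative lmul.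
Proof.
move=> p q; rewrite /lmul exchange_big /=.
by apply/eq_bigr=> b _; apply/eq_bigr=> a _; rewrite mulrC addrC.
Qed.

Lemma lmulDl : left_distributive lmul +%R.
Proof.
move=> p q r; have le0 := fsubset_refl (supp r).
rewrite [in RHS](lmulw (fsubsetUl _ (supp q)) le0).
rewrite [in RHS](lmulw (fsubsetUr (supp p) _) le0).
rewrite (lmulw (monalg.msuppD_le _ _) le0) -big_split /=; apply/eq_bigr=> a _.
rewrite -big_split /=; apply/eq_bigr=> b _.
by rewrite monalg.mcoeffD mulrDl monalgUD.
Qed.

Lemma lmul0l : left_zero 0 lmul.
Proof. by move=> p; rewrite /lmul monalg.msupp0 big_seq_fset0. Qed.

Lemma lmulDr : right_distributive lmul +%R.
Proof. by move=> p q r; rewrite lmulC lmulDl !(lmulC p). Qed.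

Lemma lmul0r : right_zero 0 lmul.
Proof. by move=> p; rewrite lmulC lmul0l. Qed.

Lemma lmul_suml (J : Type) (s : seq J) (F : J -> malg 'cV[int]_d R) q :
  lmul (\sum_(j <- s) F j) q = \sum_(j <- s) lmul (F j) q.
Proof.
exact: (big_morph (lmul^~ q) (fun x y => lmulDl x y q) (lmul0l q)).
Qed.

Lemma lmul_sumr (J : Type) (s : seq J) (F : J -> malg 'cV[int]_d R) q :
  lmul q (\sum_(j <- s) F j) = \sum_(j <- s) lmul q (F j).
Proof. exact: (big_morph (lmul q) (lmulDr q) (lmul0r q)). Qed.

Lemma lmulA : associative lmul.
Proof.
move=> p q r; rewrite [p in LHS]monalgE [p in RHS]monalgE !lmul_suml.
apply/eq_bigr=> a _; rewrite [q]monalgE lmul_sumr !lmul_suml lmul_sumr.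
apply/eq_bigr=> b _; rewrite [r]monalgE !lmul_sumr.
by apply/eq_bigr=> c _; rewrite !lmulUU mulrA addrA.
Qed.

Lemma lmul1l : left_id lone lmul.
Proof.
move=> p; rewrite [p]monalgE lmul_sumr; apply/eq_bigr=> a _.
by rewrite lmulUU mul1r add0r.
Qed.

Lemma lone_neq0 : lone != 0.
Proof. by rewrite monalgU_eq0 oner_eq0. Qed.

End LaurentMul.

(* The Laurent polynomial ring R[t_1^{+-1}, ..., t_d^{+-1}]: finitely supported
   families of coefficients in R indexed by the exponent vectors a in Z^d, with
   the convolution product. The ring structure of malg M R in monalg
   requires a monoid M without nontrivial units, so that it does not cover
   M = Z^d; only its additive structure is reused.
   mkmalgU a c denotes c t^a. *)
Definition laurent (d : nat) (R : comNzRingType) := malg 'cV[int]_d R.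

Section LaurentRing.
Variables (d : nat) (R : comNzRingType).
Implicit Types (a b : 'cV[int]_d).

HB.instance Definition _ :=
  GRing.Zmodule.copy (laurent d R) (malg 'cV[int]_d R).
HB.instance Definition _ := GRing.Zmodule_isComNzRing.Build (laurent d R)
  (@lmulA d R) (@lmulC d R) (@lmul1l d R) (@lmulDl d R) (lone_neq0 d R).

Definition tpow a : laurent d R := mkmalgU a 1.

Definition lconst (c : R) : laurent d R := mkmalgU 0 c.

Lemma tpow0 : tpow 0 = 1.
Proof. by []. Qed.

Lemma tpowD a b : tpow (a + b) = tpow a * tpow b.
Proof. by rewrite [RHS]lmulUU mulr1. Qed.

Lemma lconst_zmod_morphism : zmod_morphism lconst.
Proof. by move=> x y; rewrite /lconst monalgUB. Qed.

Lemma lconst_monoid_morphism : monoid_morphism lconst.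
Proof. by split=> // x y; rewrite [RHS]lmulUU addr0. Qed.

HB.instance Definition _ :=
  GRing.isZmodMorphism.Build R (laurent d R) lconst lconst_zmod_morphism.
HB.instance Definition _ :=
  GRing.isMonoidMorphism.Build R (laurent d R) lconst lconst_monoid_morphism.

Lemma lconstK : cancel lconst (@monalg.mcoeff 'cV[int]_d R 0).
Proof. exact: (mcoeffUU 0). Qed.

Lemma lconst_inj : injective lconst.
Proof. exact: can_inj lconstK. Qed.

End LaurentRing.

Section Ideals.
Variable R : comNzRingType.
Implicit Types (I G : R -> Prop).

(* Prop-valued and possibly improper, unlike the decidable proper ideals of
   ring_quotient. *)
Definition is_ideal I : Prop :=
  [/\ I 0, forall x y, I x -> I y -> I (x + y) & forall r x, I x -> I (r * x)].

Definition ideal_gen G : R -> Prop := fun x =>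
  exists2 s : seq (R * R), (forall u, u \in s -> G u.2) &
    x = \sum_(u <- s) u.1 * u.2.

Definition generates G I : Prop := forall x, I x <-> ideal_gen G x.

Lemma ideal_gen_is_ideal G : is_ideal (ideal_gen G).
Proof.
split=> [|x y [s Gs ->] [s' Gs' ->]|r x [s Gs ->]].
- by exists [::]; rewrite ?big_nil.
- exists (s ++ s'); last by rewrite big_cat.
  by move=> u; rewrite mem_cat => /orP[/Gs|/Gs'].
- exists [seq (r * u.1, u.2) | u <- s]; first by move=> _ /mapP[u /Gs ? ->].
  by rewrite big_map mulr_sumr; apply/eq_bigr=> u _; rewrite mulrA.
Qed.

Lemma ideal_gen_min G I :
  is_ideal I -> (forall x, G x -> I x) -> forall x, ideal_gen G x -> I x.
Proof.
move=> [I0 ID IM] GI _ [s Gs ->]; rewrite big_seq.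
by elim/big_ind: _ => // u /Gs/GI/IM.
Qed.

End Ideals.

Section Grading.
Variables (k : fieldType) (n d : nat) (A : 'M[int]_(d, n)).

Definition adeg (b : 'X_{1..n}) : 'cV[int]_d := A *m \col_i (b i)%:Z.

Definition ahomog (f : {mpoly k[n]}) : Prop :=
  exists a, forall b, b \in msupp f -> adeg b = a.

Definition agraded_ideal (J : {mpoly k[n]} -> Prop) : Prop :=
  is_ideal J /\ exists2 G, (forall g, G g -> ahomog g) & generates G J.

Definition largest_agraded_in (I J : {mpoly k[n]} -> Prop) : Prop :=
  [/\ agraded_ideal J, forall f, J f -> I f
    & forall J', agraded_ideal J' -> (forall f, J' f -> I f) ->
        forall f, J' f -> J f].

(* f |-> f(t^{a_1} x_1, ..., t^{a_n} x_n), where a_i is column i of A. *)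
Definition tsubst (f : {mpoly k[n]}) : laurent d {mpoly k[n]} :=
  mmap (fun c : k => lconst d c%:MP)
       (fun i => tpow {mpoly k[n]} (col i A) * lconst d 'X_i) f.

(* The ideal t.I, computed from a generating set G of I. *)
Definition tideal (G : {mpoly k[n]} -> Prop) : laurent d {mpoly k[n]} -> Prop :=
  ideal_gen (fun h => exists2 g, G g & h = tsubst g).

End Grading.

(* Main.v *)
(* With [phi] the automorphism of k[x][t^{+-1}] fixing t and sending x_i to
   t^{-a_i} x_i, the ideal phi(t.I) is the extension of I to k[x][t^{+-1}], so
   all coefficients of its elements lie in I. For f in (t.I) \cap k[x], the
   coefficients of phi(f) are the A-homogeneous components of f; these are
   therefore in I. Conversely, an A-homogeneous g of degree a satisfies
   g = t^{-a} g(t^{a_1} x_1, ..., t^{a_n} x_n). Hence (t.I) \cap k[x] is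
   generated by the A-homogeneous elements of I. *)
From HB Require Import structures.
Require Import Defs.
From mathcomp Require Import all_boot all_order all_algebra.
From mathcomp Require Import finmap.
From mathcomp Require Import -(notations) monalg.
From mathcomp Require Import mpoly.

Set Implicit Arguments.
Unset Strict Implicit.
Unset Printing Implicit Defensive.

Import GRing.Theory.
Local Open Scope ring_scope.

Local Notation supp := monalg.msupp.
Local Notation coef := monalg.mcoeff.

Section IdealTheory.
Variables (R : comNzRingType) (I : R -> Prop).
Hypothesis idI : is_ideal I.

Lemma ideal_sum (J : eqType) (s : seq J) (F : J -> R) :
  (forall j, j \in s -> I (F j)) -> I (\sum_(j <- s) F j).
Proof.
by case: idI => I0 ID _ FI; rewrite big_seq; elim/big_ind: _.
Qed.

Lemma ideal_genW (G : R -> Prop) x : G x -> ideal_gen G x.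
Proof.
move=> Gx; exists [:: (1, x)]; last by rewrite big_seq1 mul1r.
by move=> u; rewrite inE => /eqP->.
Qed.

End IdealTheory.

Section Laurent.
Variables (d : nat) (R : comNzRingType).
Implicit Types (p q : laurent d R) (a b : 'cV[int]_d) (c : R).

Lemma laurentE p :
  p = \sum_(a <- supp p) (mkmalgU a (coef a p) : laurent d R).
Proof. exact: monalgE. Qed.

Lemma mkmalgUM a b (c1 c2 : R) :
  (mkmalgU a c1 : laurent d R) * (mkmalgU b c2 : laurent d R) =
  mkmalgU (a + b) (c1 * c2).
Proof. exact: lmulUU. Qed.

Lemma tpowX a m : tpow R a ^+ m = tpow R (a *+ m).
Proof. by elim: m => // m IH; rewrite exprS IH -tpowD mulrS. Qed.

Lemma tpow_prod (J : Type) (s : seq J) (F : J -> 'cV[int]_d) :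
  \prod_(j <- s) tpow R (F j) = tpow R (\sum_(j <- s) F j).
Proof. by rewrite (big_morph _ (@tpowD d R) (tpow0 d R)). Qed.

Lemma mkmalgU_tpow a c : mkmalgU a c = tpow R a * lconst d c.
Proof. by rewrite mkmalgUM addr0 mul1r. Qed.

(** This ideal is the extension of [I] to the Laurent ring. Each coefficient of [r * p] is a sum of
    products of a coefficient of [r] and one of [p]. *)
Lemma is_ideal_coef (I : R -> Prop) :
  is_ideal I -> is_ideal (fun p : laurent d R => forall a, I (coef a p)).
Proof.
move=> idI; have [I0 ID IM] := idI; split=> [a|p q Ip Iq a|r p Ip a].
- by rewrite monalg.mcoeff0.
- by rewrite monalg.mcoeffD; apply: ID.
rewrite [r]laurentE [p in _ * p]laurentE mulr_suml raddf_sum /=.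
apply: ideal_sum => // b _; rewrite mulr_sumr raddf_sum /=.
apply: ideal_sum => // e _; rewrite mkmalgUM mcoeffU.
by case: eqP => _; [apply: IM | rewrite mulr0n].
Qed.

End Laurent.

Section LaurentMap.
Variables (d : nat) (R S : comNzRingType) (f : {rmorphism R -> S}).
Variable u : 'cV[int]_d -> S.
Hypotheses (u0 : u 0 = 1) (uD : forall a b, u (a + b) = u a * u b).

(** The evaluation that extends [f] and sends t^a to [u a]. *)
Definition lmap (p : laurent d R) : S := monalg.mmap f u p.

Lemma lmapU a c : lmap (mkmalgU a c) = f c * u a.
Proof. exact: mmapU. Qed.

Lemma lmap_sum (J : Type) (s : seq J) (F : J -> laurent d R) :
  lmap (\sum_(j <- s) F j) = \sum_(j <- s) lmap (F j).
Proof. exact: (raddf_sum (monalg.mmap f u)). Qed.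

Lemma lmapM p q : lmap (p * q) = lmap p * lmap q.
Proof.
rewrite [p]laurentE [q]laurentE mulr_suml !lmap_sum mulr_suml.
apply: eq_bigr => a _; rewrite mulr_sumr lmap_sum mulr_sumr.
apply: eq_bigr => b _.
by rewrite mkmalgUM !lmapU uD rmorphM mulrACA.
Qed.

Lemma lmap_lconst c : lmap (lconst d c) = f c.
Proof. by rewrite lmapU u0 mulr1. Qed.

End LaurentMap.

Section Grading.
Variables (k : fieldType) (n d : nat).
Implicit Types (A : 'M[int]_(d, n)) (f g : {mpoly k[n]}) (b : 'X_{1..n}).

Lemma adeg_sum A b : adeg A b = \sum_i col i A *+ b i.
Proof.
rewrite /adeg; apply/matrixP => i j; rewrite !mxE summxE.
by apply: eq_bigr => l _; rewrite mulmxnE !mxE -mulr_natr natz.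
Qed.

Lemma adegN A b : adeg (- A) b = - adeg A b.
Proof. by rewrite /adeg mulNmx. Qed.

Let tvar A i : laurent d {mpoly k[n]} := tpow {mpoly k[n]} (col i A) * lconst d 'X_i.

Lemma tsubst_is_zmod_morphism A : zmod_morphism (@tsubst k n d A).
Proof. exact: (mmap_is_additive (tvar A) (@lconst d _ \o @mpolyC n k)). Qed.

Lemma tsubst_is_monoid_morphism A : monoid_morphism (@tsubst k n d A).
Proof.
by have [] := mmap_is_multiplicative (tvar A) (@lconst d _ \o @mpolyC n k).
Qed.

HB.instance Definition _ A := GRing.isZmodMorphism.Build
  {mpoly k[n]} (laurent d {mpoly k[n]}) (tsubst A) (tsubst_is_zmod_morphism A).
HB.instance Definition _ A := GRing.isMonoidMorphism.Build
  {mpoly k[n]} (laurent d {mpoly k[n]}) (tsubst A) (tsubst_is_monoid_morphism A).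

(** The factor x_i^{b_i} contributes t^{b_i a_i}, and these powers multiply to t^{A b}. *)
Lemma tsubstE A f : tsubst A f =
  \sum_(b <- msupp f) mkmalgU (adeg A b) (f@_b *: 'X_[b]).
Proof.
apply: eq_bigr => b _; rewrite mkmalgU_tpow -mul_mpolyC rmorphM /= mulrCA.
congr (_ * _); rewrite /mmap1 adeg_sum -tpow_prod mpolyXE_id rmorph_prod.
by rewrite -big_split; apply: eq_bigr => i _; rewrite exprMn tpowX rmorphXn.
Qed.

Lemma tsubst_ahomog A g a : (forall b, b \in msupp g -> adeg A b = a) ->
  tsubst A g = tpow _ a * lconst d g.
Proof.
move=> ga; rewrite tsubstE [in RHS](mpolyE g) rmorph_sum mulr_sumr.
by rewrite !big_seq; apply: eq_bigr => b /ga->; rewrite mkmalgU_tpow.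
Qed.

(** The right-hand side is the homogeneous component of [f] of A-degree [a]. *)
Lemma coef_tsubst A a f : coef a (tsubst A f) =
  \sum_(b <- msupp f | adeg A b == a) f@_b *: 'X_[b].
Proof.
rewrite tsubstE raddf_sum [RHS]big_mkcond; apply: eq_bigr => b _ /=.
by rewrite mcoeffU; case: eqP.
Qed.

Lemma ahomog_coef_tsubst A a f :
  forall b, b \in msupp (coef a (tsubst A f)) -> adeg A b = a.
Proof.
move=> b; apply: contraTeq => ba; rewrite mcoeff_msupp negbK coef_tsubst.
rewrite raddf_sum big1 // => e ea; rewrite /= mcoeffZ mcoeffX.
by case: (e =P b) ba => [<-|_ _]; rewrite ?ea ?mulr0.
Qed.

(** Setting t = 1 adds up the coefficients of a Laurent polynomial, and it turns [tsubst A f] back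
    into [f]. *)
Lemma sum_coef_tsubst A f :
  f = \sum_(a <- supp (tsubst A f)) coef a (tsubst A f).
Proof.
have tot (p : laurent d {mpoly k[n]}) :
    \sum_(a <- supp p) coef a p = lmap idfun (fun=> 1) p.
  by rewrite /lmap monalg.mmapE; apply: eq_bigr => a _; rewrite mulr1.
rewrite tot tsubstE lmap_sum [LHS]mpolyE.
by apply: eq_bigr => b _; rewrite lmapU mulr1.
Qed.

(* The automorphism x_i |-> t^{-a_i} x_i of the Laurent polynomial ring. *)
Definition untwist A : laurent d {mpoly k[n]} -> laurent d {mpoly k[n]} :=
  lmap (tsubst (- A)) (@tpow d _).

(** On the term in x^b, the factor t^{-A b} from [tsubst (- A)] cancels t^{A b}. *)
Lemma untwist_tsubst A g : untwist A (tsubst A g) = lconst d g.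
Proof.
rewrite tsubstE /untwist lmap_sum [in RHS](mpolyE g) rmorph_sum.
apply: eq_bigr => b _; rewrite lmapU /= (@tsubst_ahomog _ _ (adeg (- A) b)).
  by rewrite mulrAC -tpowD adegN addNr mul1r.
by move=> e /msuppZ_le; rewrite msuppX inE => /eqP->.
Qed.

Lemma untwist_lconst A f : untwist A (lconst d f) = tsubst (- A) f.
Proof. exact: lmap_lconst. Qed.

Lemma untwistM A p q : untwist A (p * q) = untwist A p * untwist A q.
Proof. by apply: lmapM; apply: tpowD. Qed.

(** A ring morphism carries combinations of elements of [G] to combinations of their images; so t.I
    does not depend on the choice of [G]. *)
Lemma tideal_tsubst A (I G : {mpoly k[n]} -> Prop) g :
  generates G I -> I g -> tideal A G (tsubst A g).
Proof.
move=> GI /GI[s Gs ->]; exists [seq (tsubst A u.1, tsubst A u.2) | u <- s].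
  by move=> _ /mapP[u /Gs Gu ->]; exists u.2.
by rewrite big_map rmorph_sum; apply: eq_bigr => u _; rewrite rmorphM.
Qed.

(** Untwisting is multiplicative and sends each generator of t.I to a constant in [I], hence t.I
    into the extension of [I]. *)
Lemma coef_untwist_tideal A (I G : {mpoly k[n]} -> Prop) p :
  is_ideal I -> generates G I -> tideal A G p ->
  forall a, I (coef a (untwist A p)).
Proof.
move=> idI GI [s Gs ->]; have idIL := is_ideal_coef d idI.
have [I0 _ _] := idI; have [_ _ ILM] := idIL.
rewrite /untwist lmap_sum; apply: (ideal_sum idIL) => u /Gs[g Gg ug].
rewrite [lmap _ _ _](untwistM A) ug untwist_tsubst; apply: ILM => a.
rewrite mcoeffU; case: eqP => _; rewrite ?mulr0n //.
exact/GI/ideal_genW.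
Qed.

Lemma tideal_lconstP A (I G : {mpoly k[n]} -> Prop) :
  is_ideal I -> generates G I ->
  generates (fun g => ahomog A g /\ I g) (fun f => tideal A G (lconst d f)).
Proof.
move=> idI GI f; split=> [If|].
  (* The matrix is [- A] because untwisting the constant [f] gives [tsubst (- A) f]; its coefficient
     at [a] thus has A-degree [- a]. *)
  rewrite [f](sum_coef_tsubst (- A)).
  apply: (ideal_sum (ideal_gen_is_ideal _)) => a _; apply: ideal_genW; split.
    exists (- a) => b /ahomog_coef_tsubst <-; by rewrite adegN opprK.
  by rewrite -untwist_lconst; apply: coef_untwist_tideal idI GI If a.
have [T0 TD TM] := ideal_gen_is_ideal (fun h => exists2 g, G g & h = tsubst A g).
(* The preimage of t.I under the ring morphism [lconst] is an ideal, so only homogeneous [g] in [I]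
   need be considered. *)
apply: (@ideal_gen_min _ _ (fun f => tideal A G (lconst d f))) => [|g [[a ga] Ig]].
  split=> [|x y Jx Jy|r x Jx]; rewrite ?rmorph0 ?rmorphD ?rmorphM.
  - exact: T0.
  - exact: TD.
  - exact: TM.
(* Write g = t^{-a} (t^a g), where t^a g is [tsubst A g]. *)
rewrite -[lconst d g]mul1r -(tpow0 d) -(addNr a) tpowD -mulrA.
by rewrite -(tsubst_ahomog ga); apply/TM/(tideal_tsubst A GI).
Qed.

End Grading.

Theorem theorem3 (k : fieldType) (n d : nat) (A : 'M[int]_(d, n))
    (I : {mpoly k[n]} -> Prop) (hI : is_ideal I)
    (G : {mpoly k[n]} -> Prop) (hG : generates G I) :
  largest_agraded_in A I (fun f => tideal A G (lconst d f)).
Proof.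
have JP := tideal_lconstP A hI hG.
have [g0 gD gM] := ideal_gen_is_ideal (fun g => ahomog A g /\ I g).
have idJ : is_ideal (fun f => tideal A G (lconst d f)).
  by split=> [|x y /JP Jx /JP Jy|r x /JP Jx]; apply/JP; auto.
split=> [|f /JP|J' [_ [G' G'h G'J']] J'I f /G'J'].
- by split=> //; exists (fun g => ahomog A g /\ I g) => // g [].
- by apply: ideal_gen_min => // g [].
(* The homogeneous generators of [J'] lie in [I], so they are among the generators given by [JP]. *)
apply: (ideal_gen_min idJ) => // g G'g; apply/JP/ideal_genW; split; first exact: G'h.
exact/J'I/G'J'/ideal_genW.
Qed.
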